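(* Let $G$ be a forest. Then for every integer $n\ge 2$, $$\mathrm{conn}_H\bigl(I(G[K_n])\bigr)=i(G)-2.$$
   Context: A graph is a finite undirected graph with no multiple edges and no loops; $V(G)$ and $E(G)$ denote its vertex set and edge set, and $uv$ denotes the edge $\{u,v\}$. A forest is a graph without cycles. $K_n$ is the complete graph on $n$ vertices. The independence complex $I(G)$ is the abstract simplicial complex on $V(G)$ whose simplices are the independent sets of $G$, i.e. the subsets $\sigma\subset V(G)$ with $uv\notin E(G)$ for all $u,v\in\sigma$; $I(G)$ also denotes its geometric realization. The lexicographic product $G[H]$ of graphs $G,H$ is the graph with $V(G[H])=V(G)\times V(H)$ in which $(u_1,v_1)(u_2,v_2)\in E(G[H])$ if and only if either $u_1u_2\in E(G)$, or $u_1=u_2$ and $v_1v_2\in E(H)$. The closed neighborhood of $v$ in $G$ is $\overline{N}_G(v)=\{u\in V(G): uv\in E(G)\}\sqcup\{v\}$. A subset $S\subset V(G)$ is a dominating set of $G$ if $V(G)=\bigcup_{u\in S}\overline{N}_G(u)$; it is an independent dominating set if moreover $S$ is an independent set. The independent domination number $i(G)$ is the minimum cardinality of an independent dominating set of $G$. The homological connectivity $\mathrm{conn}_H(X)$ of a space $X$ is: $-2$ if $X=\emptyset$; $k$ if $\widetilde H_i(X)=0$ for all $i\le k$ and $\widetilde H_{k+1}(X)\ne 0$; $\infty$ if $\widetilde H_i(X)=0$ for all $i$ (with $X\neq\emptyset$ in the last two cases). Here $\widetilde H_i$ is the $i$th reduced homology group. *)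

(* Defs.v *)
From HB Require Import structures.
From mathcomp Require Import all_boot all_order all_algebra.
From mathcomp Require Import constructive_ereal.

Set Implicit Arguments.
Unset Strict Implicit.
Unset Printing Implicit Defensive.

Import Order.TTheory GRing.Theory Num.Theory.
Local Open Scope ring_scope.

Record sgraph := SGraph {
  vertex :> finType;
  edge : rel vertex;
  edge_sym : symmetric edge;
  edge_irrefl : irreflexive edge
}.

Section Graphs.
Variable G : sgraph.
Implicit Types S : {set G}.

Definition is_forest : Prop :=
  forall c : seq G, (2 < size c)%N -> ~ ucycle (@edge G) c.

Definition independent S : bool :=
  [forall u in S, forall v in S, ~~ edge u v].

Definition closed_nbh (v : G) : {set G} := v |: [set u | edge u v].

Definition dominating S : bool := \bigcup_(u in S) closed_nbh u == setT.

Definition indep_dominating S : bool := dominating S && independent S.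

Lemma independentP S :
  reflect {in S &, forall u v, ~~ edge u v} (independent S).
Proof.
apply: (iffP forall_inP) => [h u v uS vS | h u uS].
  exact: (forall_inP (h u uS)).
by apply/forall_inP => v vS; exact: h.
Qed.

Lemma independent0 : independent set0.
Proof. by apply/independentP => u v; rewrite inE. Qed.

Lemma independentS S S' : S' \subset S -> independent S -> independent S'.
Proof.
move=> /subsetP sS /independentP h.
by apply/independentP => u v /sS uS /sS vS; exact: h.
Qed.

Lemma indep_dominating_exists :
  exists k, [exists S, indep_dominating S && (#|S| == k)].
Proof.
have [S /maxsetP[iS maxS] _] := maxset_exists independent0.
exists #|S|; apply/existsP; exists S; rewrite eqxx andbT /indep_dominating iS.
rewrite andbT; apply/eqP/setP => v; rewrite inE; apply/bigcupP.
have [vS | vNS] := boolP (v \in S); first by exists v; rewrite // !inE eqxx.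
have [/existsP[u /andP[uS uv]] | noN] := boolP [exists u, (u \in S) && edge v u].
  by exists u; rewrite // !inE uv orbT.
suff : v |: S = S by move=> SE; rewrite -SE setU11 in vNS.
apply: maxS (subsetUr _ _); apply/independentP => x y; rewrite !inE.
have vN u : u \in S -> ~~ edge v u.
  by move=> uS; apply: contra noN => vu; apply/existsP; exists u; rewrite uS.
move=> /orP[/eqP-> | xS] /orP[/eqP-> | yS]; first by rewrite edge_irrefl.
- exact: vN.
- by rewrite edge_sym vN.
- exact: (independentP _ iS).
Qed.

Definition indep_dom_num : nat := ex_minn indep_dominating_exists.

End Graphs.

Section Lexicographic.
Variables G H : sgraph.

Definition lex_edge : rel (G * H) := fun x y =>
  edge x.1 y.1 || (x.1 == y.1) && edge x.2 y.2.

Lemma lex_edge_sym : symmetric lex_edge.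
Proof.
by move=> x y; rewrite /lex_edge edge_sym eq_sym [edge x.2 _]edge_sym.
Qed.

Lemma lex_edge_irrefl : irreflexive lex_edge.
Proof. by move=> x; rewrite /lex_edge !edge_irrefl andbF. Qed.

Definition lex_prod : sgraph := SGraph lex_edge_sym lex_edge_irrefl.

End Lexicographic.

Section Complete.
Variable n : nat.

Definition complete_edge : rel 'I_n := fun i j => i != j.

Lemma complete_edge_sym : symmetric complete_edge.
Proof. by move=> i j; rewrite /complete_edge eq_sym. Qed.

Lemma complete_edge_irrefl : irreflexive complete_edge.
Proof. by move=> i; rewrite /complete_edge eqxx. Qed.

Definition complete : sgraph := SGraph complete_edge_sym complete_edge_irrefl.

End Complete.

(* The empty simplex always belongs to the complex; the realization is the    *)
(* empty space exactly when it is the only simplex.                           *)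
Record scomplex (T : finType) := SComplex {
  simplices : {set {set T}};
  simplices0 : set0 \in simplices;
  simplicesS : forall s t : {set T},
    t \subset s -> s \in simplices -> t \in simplices
}.

Section IndependenceComplex.
Variable G : sgraph.

Definition indep_sets : {set {set G}} := [set S | independent S].

Lemma indep_sets0 : set0 \in indep_sets.
Proof. by rewrite inE independent0. Qed.

Lemma indep_setsS (s t : {set G}) :
  t \subset s -> s \in indep_sets -> t \in indep_sets.
Proof. by rewrite !inE; exact: independentS. Qed.

Definition indep_complex : scomplex G := SComplex indep_sets0 indep_setsS.

End IndependenceComplex.

(* Reduced simplicial homology with integer coefficients: the homology of the *)
(* augmented chain complex, in which the empty simplex spans degree -1.       *)
(* Simplices are oriented by the enumeration order of T.                      *)
Section ReducedHomology.
Variables (T : finType) (K : scomplex T).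
Implicit Types (s : {set T}) (c : {ffun {set T} -> int}) (k : int).

Definition basis_chain s : {ffun {set T} -> int} := [ffun t => (t == s)%:R].

Definition vertex_pos s (v : T) : nat :=
  #|[set u in s | (enum_rank u < enum_rank v)%N]|.

Definition boundary_simplex s : {ffun {set T} -> int} :=
  \sum_(v in s) basis_chain (s :\ v) *~ (-1) ^+ vertex_pos s v.

Definition boundary c : {ffun {set T} -> int} :=
  \sum_s boundary_simplex s *~ c s.

(* c is a k-chain of K; a k-simplex has k + 1 vertices *)
Definition is_chain k c : Prop :=
  forall s, c s != 0 -> s \in simplices K /\ #|s|%:Z = k + 1.

Definition is_cycle k c : Prop := is_chain k c /\ boundary c = 0.

Definition is_boundary k c : Prop :=
  exists2 d, is_chain (k + 1) d & boundary d = c.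

Definition reduced_homology_vanishes k : Prop :=
  forall c, is_cycle k c -> is_boundary k c.

(* Whether a homology group vanishes is a Prop, so conn_H is given by its     *)
(* graph: is_connH x reads conn_H(K) = x, and x is determined by K.           *)
Definition is_connH (x : \bar int) : Prop :=
  if simplices K == [set set0] then x = (-2)%:E else
  match x with
  | k%:E => (forall i, i <= k -> reduced_homology_vanishes i) /\
            ~ reduced_homology_vanishes (k + 1)
  | +oo%E => forall i, reduced_homology_vanishes i
  | -oo%E => False
  end.

Lemma is_connH_unique x y : is_connH x -> is_connH y -> x = y.
Proof.
rewrite /is_connH; case: ifP => _; first by move=> -> ->.
case: x y => [k||] [l||] //.
- move=> [hk nk] [hl nl]; congr EFin.
  case: (ltgtP k l) => // [kl|lk].
  + by case: nk; apply: hl; rewrite lezD1.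
  + by case: nl; apply: hk; rewrite lezD1.
- by move=> [_ nk] h; case: nk.
- by move=> h [_ nl]; case: nl.
Qed.

End ReducedHomology.

(* Main.v *)
Require Import Defs.
From mathcomp Require Import all_boot all_order all_algebra.
From mathcomp Require Import constructive_ereal.
From mathcomp Require Import zify ring.

Set Implicit Arguments.
Unset Strict Implicit.
Unset Printing Implicit Defensive.

Local Open Scope ring_scope.
Import GRing.Theory.

(** Write X for the independence complex of the blow-up G[K_n].  The theorem
    splits into a vanishing and a non-vanishing half, both proved on chains with
    two operators: [cone u] adds the vertex u to the simplices avoiding it, and
    [link u] removes u from the simplices containing it, each with the sign given
    by the position of u.  They satisfy the relations of exterior multiplication
    and contraction, namely d cone_u + cone_u d = 1 ([boundary_cone]) and
    d link_u + link_u d = 0 ([boundary_link]).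

    Vanishing up to degree i(G) - 2.  A forest has in every nonempty vertex set B
    a vertex with at most one neighbour in B ([forest_leaf]); over it lies, in
    every nonempty vertex set of G[K_n], a simplicial vertex, that is, one whose
    neighbours are pairwise adjacent ([forest_blowup_simplicial]).  For any graph
    with this property, an induction on the vertex set A shows that if all maximal
    independent sets of A have at least m elements, then the complex of
    independent subsets of A is acyclic on simplices with fewer than m vertices
    ([simplicial_vanishing]).  Let v be simplicial in A.  If v is isolated in A,
    the complex is a cone.  Otherwise let u be a neighbour of v; the complex is
    the deletion of u with a cone over the link of u glued on.  Every maximal
    independent set of A - u is still maximal in A, because it contains v or a
    neighbour of v, and both are adjacent to u.  Every maximal independent set of
    A - N[u] becomes maximal in A once u is added.  So the bounds m for the
    deletion and m - 1 for the link hold, and a cycle is filled first in the link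
    and then in the deletion.  Finally, a maximal independent set of G[K_n]
    projects to an independent dominating set of G, so m = i(G) is admissible
    ([blowup_maximal_indep_ge]).

    Non-vanishing in degree i(G) - 1.  Let S be an independent dominating set of
    size i(G).  The choices of one of two fixed copies of each vertex of S are the
    facets of a cross-polytope in X, whose fundamental cycle has a nonzero
    coefficient on the facet S x {i0} ([cross_polytope_facet]).  This facet is maximal in X because S dominates, and no boundary is nonzero on a
    maximal simplex ([boundary_maximal_indep]). *)

(** * Cone and link operators on chains *)

Section ChainOperators.
Variable T : finType.
Implicit Types (s t : {set T}) (u v w : T) (c d : {ffun {set T} -> int}).

Definition sgn t v : int := (-1) ^+ vertex_pos t v.

Definition cone u c : {ffun {set T} -> int} :=
  [ffun t : {set T} => if u \in t then sgn t u * c (t :\ u) else 0].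

Definition link u c : {ffun {set T} -> int} :=
  [ffun t : {set T} => if u \in t then 0 else sgn t u * c (u |: t)].

Lemma sgnK t v : sgn t v * sgn t v = 1.
Proof. by rewrite /sgn -expr2 sqrr_sign. Qed.

Lemma vertex_posU1 t u v : u \notin t ->
  vertex_pos (u |: t) v = ((enum_rank u < enum_rank v)%N + vertex_pos t v)%N.
Proof.
move=> ut; rewrite /vertex_pos.
have [uv|uv] := boolP (enum_rank u < enum_rank v)%N; last first.
  rewrite add0n; apply: eq_card => w; rewrite !inE.
  by have [->|//] := eqVneq w u; rewrite (negPf uv) !andbF.
rewrite (cardsD1 u) !inE eqxx uv /=; congr (_ + _)%N; apply: eq_card => w.
by rewrite !inE; have [->|//] := eqVneq w u; rewrite (negPf ut).
Qed.

Lemma sgn_setU1 t u : sgn (u |: t) u = sgn t u.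
Proof.
have [ut|ut] := boolP (u \in t); first by rewrite (setUidPr _) // sub1set.
by rewrite /sgn vertex_posU1 // ltnn.
Qed.

Lemma sgn_setD1 t u : sgn (t :\ u) u = sgn t u.
Proof.
have [ut|ut] := boolP (u \in t); first by rewrite -{2}(setD1K ut) sgn_setU1.
by rewrite (setDidPl _) // disjoint_sym disjoints1.
Qed.

(** Of two distinct vertices exactly one precedes the other, so inserting both
    in the two possible orders changes the total sign. *)
Lemma sgn_anticomm t u v : u != v -> u \notin t -> v \notin t ->
  sgn t v * sgn (v |: t) u = - (sgn t u * sgn (u |: t) v).
Proof.
move=> uv ut vt; rewrite /sgn !vertex_posU1 // -!exprD.
set a := vertex_pos t u; set b := vertex_pos t v.
have : enum_rank u != enum_rank v :> nat.
  by apply: contra uv => /eqP /val_inj /enum_rank_inj ->.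
rewrite neq_ltn => /orP[] H; rewrite H (leq_gtF (ltnW H)).
- by rewrite add0n add1n addnS exprS mulN1r opprK addnC.
- by rewrite add0n add1n addnS exprS mulN1r addnC.
Qed.

(** The coefficientwise form of the boundary, indexed by the vertex to add rather
    than the vertex to remove; all later computations use it. *)
Lemma boundaryE c t :
  boundary c t = \sum_(v | v \notin t) sgn t v * c (v |: t).
Proof.
rewrite /boundary sum_ffunE.
transitivity (\sum_(s : {set T}) \sum_(v in s) (t == s :\ v)%:R * sgn s v * c s).
  apply: eq_bigr => s _; rewrite ffunMzE /boundary_simplex sum_ffunE -mulrzr intz.
  rewrite big_distrl /=; apply: eq_bigr => v _.
  by rewrite ffunMzE ffunE -mulrzr intz.
rewrite (exchange_big_dep predT) //= [RHS]big_mkcond; apply: eq_bigr => v _.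
have [vt|vt] := boolP (v \in t).
  apply: big1 => s vs; case: eqP => [E|]; last by rewrite !mul0r.
  by move: vt; rewrite E !inE eqxx.
rewrite (bigD1 (v |: t)) ?setU11 //= setU1K // eqxx mul1r sgn_setU1 big1 ?addr0 //.
move=> s /andP[vs sE]; case: eqP => [E|]; last by rewrite !mul0r.
by case/eqP: sE; rewrite E setD1K.
Qed.

Lemma boundaryB c d : boundary (c - d) = boundary c - boundary d.
Proof.
apply/ffunP => t; rewrite !ffunE !boundaryE -sumrB.
by apply: eq_bigr => v _; rewrite !ffunE mulrBr.
Qed.

Lemma boundary0 : boundary (0 : {ffun {set T} -> int}) = 0.
Proof. by have := boundaryB 0 0; rewrite !subrr. Qed.

Lemma cone0 u : cone u 0 = 0.
Proof. by apply/ffunP => t; rewrite !ffunE mulr0 if_same. Qed.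

Lemma link0 u : link u 0 = 0.
Proof. by apply/ffunP => t; rewrite !ffunE mulr0 if_same. Qed.

(** Coning is a contracting homotopy of the full simplex: on a simplex without u
    only the term that removes u again survives, and on a simplex with u the other
    terms cancel by [sgn_anticomm]. *)
Lemma boundary_cone u c : boundary (cone u c) = c - cone u (boundary c).
Proof.
apply/ffunP => t; rewrite boundaryE !ffunE boundaryE.
have [ut|ut] := boolP (u \in t).
  rewrite [in RHS](bigD1 u) ?setD11 //= setD1K // mulrDr sgn_setD1 mulrA sgnK mul1r.
  rewrite opprD addrA subrr sub0r big_distrr -sumrN /=.
  apply: eq_big => [v|v vt].
    by rewrite !inE negb_and negbK; have [->|_] := eqVneq v u; rewrite ?ut ?andbT.
  have vu : u != v by apply: contraNneq (vt) => <-.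
  have vt' : v \notin t :\ u by rewrite !inE negb_and vt orbT.
  rewrite ffunE inE ut orbT -{1 2}(setD1K ut) !mulrA.
  have -> : (v |: t) :\ u = v |: (t :\ u).
    apply/setP => w; rewrite !inE; have [->|] := eqVneq w u => //=.
    by rewrite (negPf vu).
  rewrite setD1K // -mulNr; congr (_ * _).
  have := sgn_anticomm vu (negbT (setD11 u t)) vt'.
  rewrite setD1K // sgn_setD1 => E.
  have -> : sgn (v |: t) u = sgn (v |: t :\ u) u.
    by rewrite -[in LHS](setD1K ut) setUCA sgn_setU1.
  have -> : sgn (v |: t :\ u) u = - (sgn (t :\ u) v * sgn t u * sgn t v).
    by rewrite -[LHS]mul1r -(sgnK (t :\ u) v) -mulrA E mulrN mulrA.
  by rewrite -[RHS]mulr1 -(sgnK t v); ring.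
rewrite subr0 (bigD1 u) //= ffunE setU11 setU1K // sgn_setU1 mulrA sgnK mul1r.
rewrite big1 ?addr0 // => v /andP[vt vu].
by rewrite ffunE !inE eq_sym (negPf vu) (negPf ut) mulr0.
Qed.

Lemma boundary_link u c : boundary (link u c) = - link u (boundary c).
Proof.
apply/ffunP => t; rewrite boundaryE !ffunE boundaryE.
have [ut|ut] := boolP (u \in t).
  by rewrite oppr0 big1 // => v _; rewrite ffunE inE ut orbT mulr0.
rewrite (bigD1 u) //= ffunE setU11 mulr0 add0r big_distrr -sumrN /=.
apply: eq_big => [v|v /andP[vt vu]]; first by rewrite !inE negb_or andbC.
rewrite ffunE !inE eq_sym (negPf vu) (negPf ut) /= !mulrA -mulNr setUCA.
by rewrite sgn_anticomm // eq_sym.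
Qed.

End ChainOperators.

(** * Vanishing for graphs with hereditary simplicial vertices *)

Section Vanishing.
Variable H : sgraph.
Implicit Types (A B S s t : {set H}) (p m : nat) (u v x y : H)
  (c d : {ffun {set H} -> int}).

Definition simplicial A v : Prop :=
  {in A &, forall x y, edge v x -> edge v y -> x != y -> edge x y}.

(** Graded by the number p of vertices instead of the dimension p - 1, so that the
    empty simplex needs no negative index. *)
Definition indep_chain A p c : Prop :=
  forall s, c s != 0 -> [/\ s \subset A, independent s & #|s| = p].

Definition maximal_indep A S : Prop :=
  [/\ S \subset A, independent S
    & forall x, x \in A -> x \notin S -> exists2 y, y \in S & edge x y].

Lemma independentU1 u S : (forall x, x \in S -> ~~ edge u x) ->
  independent S -> independent (u |: S).
Proof.
move=> uS /independentP iS; apply/independentP => x y; rewrite !inE.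
move=> /orP[/eqP->|xS] /orP[/eqP->|yS]; first by rewrite edge_irrefl.
- exact: uS.
- by rewrite edge_sym uS.
- exact: iS.
Qed.

Lemma cone_supp u c s : cone u c s != 0 -> u \in s /\ c (s :\ u) != 0.
Proof.
by rewrite ffunE; case: ifP => [us|]; rewrite ?eqxx // mulf_eq0 negb_or => /andP[].
Qed.

Lemma link_supp u c s : link u c s != 0 -> u \notin s /\ c (u |: s) != 0.
Proof.
by rewrite ffunE; case: ifP => [|us]; rewrite ?eqxx // mulf_eq0 negb_or => /andP[].
Qed.

Lemma cone_indep_chain A B p u c : u \in A -> B \subset A ->
    (forall x, x \in B -> ~~ edge u x) ->
  indep_chain B p c -> indep_chain A p.+1 (cone u c).
Proof.
move=> uA BA uB hc s /cone_supp[us /hc[sB isu su]]; split.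
- by rewrite -(setD1K us) subUset sub1set uA (subset_trans sB).
- rewrite -(setD1K us); apply: independentU1 => // x /(subsetP sB); exact: uB.
- by rewrite (cardsD1 u) us su.
Qed.

Lemma link_indep_chain A p u c : indep_chain A p.+1 c ->
  indep_chain (A :\: closed_nbh u) p (link u c).
Proof.
move=> hc s /link_supp[us /hc[]]; rewrite subUset sub1set => /andP[uA sA] isu.
rewrite cardsU1 us add1n => -[ps]; split => //; last first.
  exact: independentS (subsetUr _ _) isu.
rewrite subsetD sA disjoint_subset; apply/subsetP => x xs; rewrite !inE negb_or.
rewrite (memPn us) //=; move/independentP: isu => /(_ x u); apply; first exact: setU1r.
exact: setU11.
Qed.

(** [cone u (link u c)] is exactly the part of c on the simplices containing u. *)
Lemma deletion_indep_chain A p u c :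
  indep_chain A p c -> indep_chain (A :\ u) p (c - cone u (link u c)).
Proof.
move=> hc s; rewrite !ffunE; have [us|us] := boolP (u \in s).
  by rewrite setD11 setD1K // sgn_setD1 mulrA sgnK mul1r subrr eqxx.
by rewrite subr0 => /hc[sA iS sp]; rewrite subsetD1 sA.
Qed.

(** If v is missing from S, then S contains a neighbour of v, which is adjacent to
    the neighbour u of v by simpliciality; so S blocks u in every case. *)
Lemma maximal_indep_deletion A u v S : v \in A -> simplicial A v ->
  u \in A -> edge v u -> maximal_indep (A :\ u) S -> maximal_indep A S.
Proof.
move=> vA sv uA vu [SA iS mS]; split=> //; first exact: subset_trans SA (subD1set _ _).
move=> x xA xS; have [xu|xu] := eqVneq x u; last by apply: mS; rewrite // !inE xu.
rewrite {x xA xS}xu; have [vS|vS] := boolP (v \in S).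
  by exists v; rewrite // edge_sym.
have vD : v \in A :\ u.
  by rewrite !inE vA andbT; apply: contraTneq vu => ->; rewrite edge_irrefl.
have [y yS vy] := mS _ vD vS; exists y => //.
have := subsetP SA _ yS; rewrite !inE => /andP[yu yA].
by apply: sv; rewrite // eq_sym.
Qed.

Lemma maximal_indep_link A u S : u \in A ->
  maximal_indep (A :\: closed_nbh u) S -> maximal_indep A (u |: S).
Proof.
move=> uA [SA iS mS]; have SN x : x \in S -> ~~ edge u x.
  by move=> /(subsetP SA); rewrite !inE negb_or edge_sym => /andP[/andP[]].
split.
- by rewrite subUset sub1set uA (subset_trans SA) ?subsetDl.
- exact: independentU1.
- move=> x xA; rewrite !inE negb_or => /andP[xu xS].
  have [xuE|xuE] := boolP (edge x u); first by exists u; rewrite // setU11.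
  have [|y yS xy] := mS x _ xS; first by rewrite !inE xA (negPf xu) (negPf xuE).
  by exists y; rewrite // !inE yS orbT.
Qed.

(** A simplex that cannot be enlarged is a proper face of nothing. *)
Lemma boundary_maximal_indep S p d :
  maximal_indep setT S -> indep_chain setT p d -> boundary d S = 0.
Proof.
move=> [_ _ mS] hd; rewrite boundaryE big1 // => x xS.
have [->|/hd[_ /independentP ind _]] := eqVneq (d (x |: S)) 0.
  by rewrite mulr0.
have [y yS xy] := mS x (in_setT _) xS.
by case/negP: (ind x y (setU11 _ _) (setU1r _ yS)).
Qed.

(** The Mayer-Vietoris argument for the deletion and the link of a vertex u, done
    on chains. *)
Lemma simplicial_vanishing A m p c :
    (forall B, B != set0 -> exists2 v, v \in B & simplicial B v) ->
    (forall S, maximal_indep A S -> (m <= #|S|)%N) -> (p < m)%N ->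
    indep_chain A p c -> boundary c = 0 ->
  exists2 d, indep_chain A p.+1 d & boundary d = c.
Proof.
move=> simplicialH; have [n] := ubnP #|A|.
elim: n => // n IH in A m p c *; rewrite ltnS => An mA pm cA c0.
have [A0|A0] := eqVneq A set0.
  have : (m <= 0)%N.
    rewrite -(cards0 H); apply: mA; rewrite A0; split=> //; first exact: independent0.
    by move=> x; rewrite inE.
  by rewrite leqNgt (leq_ltn_trans _ pm).
have [v vA sv] := simplicialH _ A0.
have [/exists_inP[u uA vu]|noN] := boolP [exists u in A, edge v u]; last first.
  exists (cone v c); last by rewrite boundary_cone c0 cone0 subr0.
  apply: cone_indep_chain cA => // x xA.
  by apply: contra noN => vx; apply/exists_inP; exists x.
have Du : (#|A :\ u| < n)%N by rewrite (leq_trans _ An) // [X in (_ < X)%N](cardsD1 u) uA.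
have [d1 d1A d1E] : exists2 d1,
    indep_chain (A :\: closed_nbh u) p d1 & boundary d1 = link u c.
  case: p => [|p] in pm cA *.
    (* A chain on the empty simplex has no link part. *)
    have l0 : link u c = 0.
      apply/ffunP => s; rewrite [RHS]ffunE; apply/eqP; apply: contraTT isT.
      by move=> /link_supp[us /cA[_ _]]; rewrite cardsU1 us.
    exists 0; first by move=> s; rewrite ffunE eqxx.
    by rewrite l0 boundary0.
  apply: (IH _ m.-1).
  - apply: leq_ltn_trans Du; apply: subset_leq_card; apply: setDS.
    by rewrite sub1set setU11.
  - move=> S mS; have /mA := maximal_indep_link uA mS.
    by rewrite cardsU1; case: mS => SA _ _; lia.
  - lia.
  - exact: link_indep_chain.
  - by rewrite boundary_link c0 link0 oppr0.
(* Subtracting the boundary of a cone over d1 moves c into the deletion of u.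
   The summand d1 is written as - (0 - d1) to have [boundaryB] apply to it. *)
have [d0 d0A d0E] : exists2 d0, indep_chain (A :\ u) p.+1 d0 &
    boundary d0 = c - cone u (link u c) - (0 - d1).
  apply: (IH _ m) => //.
  - by move=> S /(maximal_indep_deletion vA sv uA vu) /mA.
  - move=> s; rewrite sub0r opprK ffunE.
    have [-> |c0s _] := eqVneq ((c - cone u (link u c)) s) 0; last first.
      exact: deletion_indep_chain c0s.
    rewrite add0r => /d1A[sA iS sp]; split=> //; apply: subset_trans sA _.
    by apply: setDS; rewrite sub1set setU11.
  - rewrite !boundaryB boundary0 sub0r opprK boundary_cone boundary_link c0 link0.
    by rewrite oppr0 cone0 subr0 sub0r d1E addNr.
exists (d0 - cone u d1); last first.
  rewrite boundaryB boundary_cone d1E d0E sub0r opprK.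
  by rewrite opprB [_ - d1]addrC addrA addrK subrK.
move=> s; rewrite !ffunE.
have [d0s|d0s _] := eqVneq (d0 s) 0; last first.
  by have [sA ? ?] := d0A _ d0s; split=> //; apply: subset_trans sA (subD1set _ _).
rewrite d0s sub0r oppr_eq0 => h.
apply: (@cone_indep_chain A (A :\: closed_nbh u) p u d1) => //.
- exact: subsetDl.
- by move=> x; rewrite !inE negb_or edge_sym => /andP[/andP[]].
- by rewrite ffunE.
Qed.

End Vanishing.

(** * Leaves of forests *)

Section Forests.
Variable G : sgraph.
Implicit Types (x y v g : G) (p : seq G) (B : {set G}).

(** The part of the path from x to y closes up to a cycle; it has at least three
    vertices as y is not the first vertex after x. *)
Lemma forest_no_chord x y p : is_forest G ->
  path (@edge G) x p -> uniq (x :: p) -> y \in p -> y != head x p -> ~~ edge y x.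
Proof.
move=> forG + + yp; case/splitPr: yp => [p1 p2].
case: p1 => [|z p1] pathp uniqp; rewrite ?eqxx //= => _; apply/negP => yx.
apply: (forG (x :: rcons (z :: p1) y)); first by rewrite /= size_rcons.
move: pathp uniqp; rewrite cat_path -cat_rcons -[x :: _ ++ p2]cat_cons cat_uniq.
case/andP=> p1P /andP[lasty _] /andP[uniqp _].
apply/andP; split; last exact: uniqp.
by rewrite /cycle rcons_path last_rcons yx rcons_path p1P lasty.
Qed.

(** Otherwise every path in B could be extended at its head: of two neighbours of
    the head, one is not the next vertex of the path, and it is off the path by
    [forest_no_chord].  So there would be arbitrarily long simple paths. *)
Lemma forest_leaf B : is_forest G -> B != set0 ->
  exists2 v, v \in B & {in B &, forall x y, edge v x -> edge v y -> x = y}.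
Proof.
move=> forG /set0Pn[v0 v0B].
pose leaf v := [forall x in B, forall y in B, edge v x ==> edge v y ==> (x == y)].
have [/exists_inP[v vB vl]|noleaf] := boolP [exists v in B, leaf v].
  exists v => // x y xB yB vx vy; apply/eqP.
  have := forall_inP (forall_inP vl x xB) y yB.
  by rewrite vx vy.
have long k : exists x p, [/\ size p = k, x \in B, path (@edge G) x p & uniq (x :: p)].
  elim: k => [|k [x [p [sp xB pathp uniqp]]]]; first by exists v0, [::].
  have [y [yB xy yh]] : exists y, [/\ y \in B, edge x y & y != head x p].
    have : ~~ leaf x by apply: contra noleaf => lx; apply/exists_inP; exists x.
    case/forall_inPn => a aB /forall_inPn[b bB].
    rewrite !negb_imply => /and3P[xa xb ab].
    have [ah|ah] := eqVneq a (head x p); last by exists a.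
    by exists b; rewrite bB xb -ah eq_sym ab.
  exists y, (x :: p); rewrite /= sp yB edge_sym xy pathp; split=> //.
  rewrite -[_ && uniq p]/(uniq (x :: p)) uniqp andbT inE negb_or; apply/andP; split.
    by apply: contraTneq xy => ->; rewrite edge_irrefl.
  apply: contraL xy => yp; rewrite edge_sym; exact: forest_no_chord yh.
have [x [p [sp _ _ /card_uniqP up]]] := long #|G|.
by have := max_card (mem (x :: p)); rewrite up /= sp ltnn.
Qed.

End Forests.

(** * The blow-up of a graph by complete graphs *)

Section Blowup.
Variables (G : sgraph) (n : nat).
Let H := lex_prod G (complete n).
Implicit Types (A S t : {set H}) (x y v : H) (g : G) (l : seq G) (i : 'I_n).

Lemma lex_complete_edgeE x y :
  edge x y = edge x.1 y.1 || (x.1 == y.1) && (x.2 != y.2).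
Proof. by []. Qed.

(** Over a leaf g of the projection with neighbour h, the neighbours of a vertex
    lie in the two fibres over g and h, which together form a clique. *)
Lemma forest_blowup_simplicial A : is_forest G -> A != set0 ->
  exists2 v, v \in A & simplicial A v.
Proof.
move=> forG /set0Pn[a aA].
have [|_ /imsetP[v vA ->] leafv] := @forest_leaf _ [set x.1 | x in A] forG.
  by apply/set0Pn; exists a.1; apply: imset_f.
exists v => // x y xA yA; rewrite !lex_complete_edgeE.
have xN : x.1 = y.1 -> x != y -> x.2 != y.2.
  by case: x y {xA yA} => [x1 x2] [y1 y2] /= ->; apply: contra => /eqP->.
move=> /orP[vx|/andP[/eqP vx _]] /orP[vy|/andP[/eqP vy _]] xy.
- have E : x.1 = y.1 by apply: leafv => //; exact: imset_f.
  by rewrite E eqxx xN ?orbT.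
- by rewrite -vy edge_sym vx.
- by rewrite -vx vy.
- by rewrite -vx vy eqxx xN ?orbT // -vx.
Qed.

(** The projection of S to G is an independent dominating set: a vertex g is
    dominated because any vertex over g lies in S or has a neighbour in S. *)
Lemma blowup_maximal_indep_ge S : (0 < n)%N ->
  maximal_indep setT S -> (indep_dom_num G <= #|S|)%N.
Proof.
move=> n0 [_ /independentP iS mS]; apply: leq_trans (leq_imset_card fst S).
rewrite /indep_dom_num; case: ex_minnP => m _; apply; apply/existsP.
exists [set x.1 | x in S]; rewrite eqxx andbT; apply/andP; split; last first.
  apply/independentP => _ _ /imsetP[x xS ->] /imsetP[y yS ->].
  by have := iS x y xS yS; rewrite lex_complete_edgeE negb_or => /andP[].
apply/eqP/setP => g; rewrite inE; apply/bigcupP.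
pose x : H := (g, Ordinal n0).
have [xS|xS] := boolP (x \in S).
  by exists g; rewrite ?inE ?eqxx //; apply/imsetP; exists x.
have [y yS] := mS x (in_setT _) xS; rewrite lex_complete_edgeE => xy.
exists y.1; first exact: imset_f.
by rewrite !inE; case/orP: xy => [->|/andP[->]]; rewrite ?orbT.
Qed.

Variables i0 i1 : 'I_n.

(** The fundamental cycle of the join of the 0-spheres {(g, i0), (g, i1)} for g in
    l, built by iterated suspension of the empty simplex. *)
Fixpoint cross_polytope l : {ffun {set H} -> int} :=
  if l is g :: l' then
    cone ((g, i0) : H) (cross_polytope l') - cone ((g, i1) : H) (cross_polytope l')
  else basis_chain set0.

Lemma cross_polytope_cycle l : boundary (cross_polytope l) = 0.
Proof.
elim: l => [|g l IH] /=; last by rewrite boundaryB !boundary_cone IH !cone0 subrr.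
apply/ffunP => t; rewrite boundaryE ffunE big1 // => v _; rewrite ffunE.
by case: eqP => [E|]; rewrite ?mulr0 //; have := setU11 v t; rewrite E inE.
Qed.

Lemma cross_polytope_indep l : uniq l -> {in l &, forall a b : G, ~~ edge a b} ->
  indep_chain [set x : H | x.1 \in l] (size l) (cross_polytope l).
Proof.
elim: l => [|g l IH] /= => [_ _ s|/andP[gl ul] il s].
  rewrite ffunE; case: (s =P set0) => [-> _|]; last by rewrite eqxx.
  by rewrite sub0set independent0 cards0.
have {}IH : indep_chain [set x : H | x.1 \in l] (size l) (cross_polytope l).
  by apply: IH => // a b al bl; apply: il; rewrite inE ?al ?bl orbT.
have coneP i : indep_chain [set x : H | x.1 \in g :: l] (size l).+1
    (cone ((g, i) : H) (cross_polytope l)).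
  apply: cone_indep_chain IH; first by rewrite !inE eqxx.
    by apply/subsetP => x; rewrite !inE => ->; rewrite orbT.
  move=> x; rewrite inE => xl; rewrite lex_complete_edgeE negb_or negb_and /=.
  rewrite il ?inE ?eqxx ?xl ?orbT //=.
  by apply/orP; left; apply: contraNneq gl => ->.
rewrite !ffunE.
have [E|c0 _] := eqVneq (cone ((g, i0) : H) (cross_polytope l) s) 0.
  rewrite ffunE in E; rewrite E sub0r oppr_eq0 => c1.
  by apply: (coneP i1); rewrite ffunE.
exact: (coneP i0).
Qed.

(** The facet avoids every (g, i1), so only the cones with apex (g, i0) contribute
    and its coefficient is a product of signs. *)
Lemma cross_polytope_facet l : i0 != i1 -> uniq l ->
  cross_polytope l [set x : H | (x.1 \in l) && (x.2 == i0)] != 0.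
Proof.
move=> i01; elim: l => [|g l IH] /= => [_|/andP[gl /IH{}IH]].
  have -> : [set x : H | (x.1 \in [::]) && (x.2 == i0)] = set0.
    by apply/setP => x; rewrite !inE.
  by rewrite ffunE eqxx.
rewrite !ffunE !inE /= eqxx [i1 == i0]eq_sym (negPf i01) /= subr0 eqxx /=.
rewrite mulf_neq0 ?signr_eq0 //.
suff -> : [set x : H | (x.1 \in g :: l) && (x.2 == i0)] :\ (g, i0) =
    [set x : H | (x.1 \in l) && (x.2 == i0)] by [].
apply/setP => x; rewrite !inE; case: x => [a b] /=; rewrite xpair_eqE.
have [->|//] := eqVneq a g; rewrite (negPf gl) /=.
by case: (b == i0).
Qed.

End Blowup.

(** * Connectivity of the independence complex *)

Theorem theorem4p3 (G : sgraph) (hG : is_forest G) (n : nat)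
    (hn : (2 <= n)%N) :
  is_connH (indep_complex (lex_prod G (complete n)))
           ((indep_dom_num G)%:Z - 2)%:E.
Proof.
have n0 : (0 < n)%N := ltnW hn.
pose i0 := Ordinal n0; pose i1 := Ordinal hn.
have [S domS [iS cardS]] :
    exists2 S : {set G}, dominating S & independent S /\ #|S| = indep_dom_num G.
  rewrite /indep_dom_num; case: ex_minnP => m /existsP[S /andP[/andP[? ?] /eqP?]] _.
  by exists S.
rewrite /is_connH; case: ifP => [/eqP K0|_].
  (* As n > 0, the complex is empty only if G has no vertices. *)
  suff S0 : S = set0 by rewrite -cardS S0 cards0.
  apply/setP => g; rewrite inE; apply/negP => gS.
  have : [set ((g, i0) : lex_prod G (complete n))] \in [set set0].
    rewrite -K0 inE; apply/independentP => x y; rewrite !inE => /eqP-> /eqP->.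
    by rewrite edge_irrefl.
  by rewrite inE => /eqP/setP/(_ (g, i0)); rewrite !inE eqxx.
split=> [k kle c [cC c0]|vanish].
  have [kneg|[p kE]] : (k + 1 < 0) \/ exists p : nat, k + 1 = p%:Z.
    by case: (k + 1) => p; [right; exists p|left].
    (* Below degree -1 there are no nonzero chains. *)
    exists 0; last first.
      rewrite boundary0; apply/ffunP => s; rewrite ffunE.
      apply/eqP; rewrite eq_sym; apply: contraTT isT => /cC[_]; lia.
    by move=> s; rewrite ffunE eqxx.
  have pm : (p < indep_dom_num G)%N by lia.
  have [|d dC dE] := simplicial_vanishing
    (fun A => @forest_blowup_simplicial G n A hG)
    (fun S => @blowup_maximal_indep_ge G n S n0) pm _ c0.
    move=> s /cC[]; rewrite inE => si; rewrite kE => sp; split=> //.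
    by case: sp.
  exists d => // s /dC[_ si sp]; rewrite inE si; split=> //; lia.
pose l := enum S.
have lS g : (g \in l) = (g \in S) by rewrite mem_enum.
have il : {in l &, forall a b : G, ~~ edge a b}.
  by move=> a b; rewrite !lS; exact: (independentP _ iS).
have [d dC dE] : is_boundary (indep_complex (lex_prod G (complete n)))
    ((indep_dom_num G)%:Z - 2 + 1) (cross_polytope i0 i1 l).
  apply: vanish; split; last exact: cross_polytope_cycle.
  move=> s /(cross_polytope_indep (enum_uniq _) il)[_ si sp].
  by rewrite inE si; split=> //; rewrite sp -cardE cardS; lia.
pose F := [set x : lex_prod G (complete n) | (x.1 \in l) && (x.2 == i0)].
have mF : maximal_indep setT F.
  split; first exact: subsetT.
    apply/independentP => x y; rewrite !inE => /andP[xl /eqP xi] /andP[yl /eqP yi].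
    by rewrite lex_complete_edgeE negb_or il // xi yi eqxx andbF.
  move=> x _ xF; have : x.1 \in \bigcup_(u in S) closed_nbh u.
    by rewrite (eqP domS) inE.
  case/bigcupP => g gS xg; exists (g, i0); first by rewrite inE /= lS gS eqxx.
  rewrite lex_complete_edgeE; move: xg; rewrite !inE => /orP[/eqP xg|->] //.
  by move: xF; rewrite inE lS xg gS eqxx /= => ->; rewrite orbT.
have i01 : i0 != i1 by [].
have /eqP[] := cross_polytope_facet i01 (enum_uniq S).
rewrite -dE; apply: (boundary_maximal_indep (p := (indep_dom_num G).+1)) mF _.
by move=> s /dC[]; rewrite inE => si sp; split=> //; lia.
Qed.
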